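(* Let $\mathcal{Q}\subseteq\mathfrak{P}_c(\Omega)$ be non-empty. Then a non-empty set $\mathcal{C}\subseteq L^0_c$ is $\mathcal{P}$-sensitive with reduction set $\mathcal{Q}$ if and only if $\mathcal{C}$ is $\mathcal{Q}$-stable.
   Context: $(\Omega,\mathcal{F})$ is an arbitrary measurable space, $\mathfrak{P}(\Omega)$ the set of probability measures on it, and $\mathcal{P}\subseteq\mathfrak{P}(\Omega)$ a fixed non-empty set. Put $c[A]:=\sup_{P\in\mathcal{P}}P[A]$, $A\in\mathcal{F}$. An event $A$ is $\mathcal{P}$-polar if $c[A]=0$; a property holds $\mathcal{P}$-q.s. if it holds outside a $\mathcal{P}$-polar event. $\mathfrak{P}_c(\Omega)$ is the set of $Q\in\mathfrak{P}(\Omega)$ with $Q[N]=0$ for every $\mathcal{P}$-polar $N$. $L^0_c$ is the space of real-valued random variables on $(\Omega,\mathcal{F})$ modulo $\mathcal{P}$-q.s. equality. For $Q\in\mathfrak{P}_c(\Omega)$ and $X,Y\in L^0_c$, $Q[X=Y]$ is evaluated on arbitrary representatives. $L^0_Q$ denotes random variables modulo $Q$-a.s. equality, and $j_Q:L^0_c\to L^0_Q$ maps the $\mathcal{P}$-q.s. class of $f$ to its $Q$-a.s. class. $\mathcal{C}\subseteq L^0_c$ is $\mathcal{P}$-sensitive if $\mathcal{C}=\bigcap_{Q\in\mathfrak{P}_c(\Omega)}j_Q^{-1}(j_Q(\mathcal{C}))$. A non-empty $\mathcal{Q}\subseteq\mathfrak{P}_c(\Omega)$ is a reduction set for $\mathcal{C}$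 if $\mathcal{C}=\bigcap_{Q\in\mathcal{Q}}j_Q^{-1}(j_Q(\mathcal{C}))$. A family $(X^Q)_{Q\in\mathcal{Q}}\subseteq L^0_c$ is $\mathcal{Q}$-coherent if there is $X^{\mathcal{Q}}\in L^0_c$ with $Q[X^Q=X^{\mathcal{Q}}]=1$ for all $Q\in\mathcal{Q}$; any such $X^{\mathcal{Q}}$ is called a $\mathcal{Q}$-aggregator of the family. A set $\mathcal{C}\subseteq L^0_c$ is $\mathcal{Q}$-stable if for every $\mathcal{Q}$-coherent family $(X^Q)_{Q\in\mathcal{Q}}\subseteq\mathcal{C}$ the set $\mathcal{C}$ contains all $\mathcal{Q}$-aggregators of $(X^Q)_{Q\in\mathcal{Q}}$. *)

(* Defs.v *)
From HB Require Import structures.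
From mathcomp Require Import all_boot generic_quotient all_order all_algebra.
From mathcomp Require Import all_classical all_reals all_analysis.

Set Implicit Arguments.
Unset Strict Implicit.
Unset Printing Implicit Defensive.

Import Order.TTheory GRing.Theory Num.Theory.
Import numFieldNormedType.Exports.

Local Open Scope classical_set_scope.
Local Open Scope ring_scope.
Local Open Scope quotient_scope.

Section quasi_sure.
Context (d : measure_display) (Omega : measurableType d) (R : realType).
Implicit Types (P : set (probability Omega R)) (Q : probability Omega R).
Implicit Types (A N : set Omega) (f g : {mfun Omega >-> R}).

Definition capacity P A : \bar R := ereal_sup [set p A | p in P].

Definition polar P N := measurable N /\ capacity P N = 0%E.

Definition quasi_surely P (prop : set Omega) :=
  exists2 N, polar P N & ~` N `<=` prop.

Definition dominated P : set (probability Omega R) :=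
  [set Q | forall N, polar P N -> Q N = 0%E].

Definition qs_eq P f g := quasi_surely P [set w | f w = g w].

Lemma capacity_eq0 P A : P !=set0 ->
  capacity P A = 0%E <-> (forall p, P p -> p A = 0%E).
Proof.
move=> [p0 Pp0]; split=> [cA0 p Pp|A0].
  apply/eqP; rewrite eq_le measure_ge0 andbT -cA0.
  by apply: ereal_sup_ubound; exists p.
rewrite /capacity (_ : [set _ | _ in _] = [set 0%E]) ?ereal_sup1//.
apply/seteqP; split=> [_ [p Pp <-]|_ ->]; first exact: A0.
by exists p0 => //; exact: A0.
Qed.

Lemma polar0 P : P !=set0 -> polar P set0.
Proof. by move=> P0; split=> //; apply/capacity_eq0 => // p _; rewrite measure0. Qed.

Lemma polarU P N1 N2 : P !=set0 ->
  polar P N1 -> polar P N2 -> polar P (N1 `|` N2).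
Proof.
move=> P0 [mN1 /(capacity_eq0 _ P0) c1] [mN2 /(capacity_eq0 _ P0) c2].
split; first exact: measurableU.
apply/(capacity_eq0 _ P0) => p Pp; apply: null_set_setU => //.
- exact: c1.
- exact: c2.
Qed.

(* A supremum over the empty set is -oo, for which no event would be polar,
   so being an equivalence relation requires P !=set0. *)
Definition qs_eq_op P (P0 : P !=set0) f g := `[< qs_eq P f g >].

Section equivalence.
Variables (P : set (probability Omega R)) (P0 : P !=set0).

Lemma qs_eq_op_refl : reflexive (qs_eq_op P0).
Proof. by move=> f; apply/asboolP; exists set0 => //; exact: polar0. Qed.

Lemma qs_eq_op_sym : symmetric (qs_eq_op P0).
Proof.
by move=> f g; apply/idP/idP => /asboolP[N pN sN]; apply/asboolP;
  exists N => // w /sN /= ->.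
Qed.

Lemma qs_eq_op_trans : transitive (qs_eq_op P0).
Proof.
move=> g f h /asboolP[N1 p1 s1] /asboolP[N2 p2 s2]; apply/asboolP.
exists (N1 `|` N2); first exact: polarU.
by rewrite setCU => w [/s1 /= -> /s2].
Qed.

Canonical qs_eq_op_canonical :=
  EquivRel (qs_eq_op P0) qs_eq_op_refl qs_eq_op_sym qs_eq_op_trans.

Definition L0c : Type := {eq_quot qs_eq_op P0}.
HB.instance Definition _ := Choice.on L0c.
HB.instance Definition _ := EqQuotient.on L0c.

(* Meaningful for dominated Q: there it does not depend on the representative
   (lemma jmapE). *)
Definition jmap Q (X : L0c) : {mfun_ Q, Omega >-> R} :=
  \pi_({mfun_ Q, Omega >-> R}) (repr X).

(* Q[X = Y]; likewise independent of the representatives for dominated Q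
   (lemma prob_eqE). *)
Definition prob_eq Q (X Y : L0c) : \bar R :=
  Q [set w | (repr X : {mfun Omega >-> R}) w = (repr Y : {mfun Omega >-> R}) w].

Definition jclosure (QQ : set (probability Omega R)) (C : set L0c) : set L0c :=
  \bigcap_(Q in QQ) (jmap Q @^-1` (jmap Q @` C)).

Definition sensitive (C : set L0c) := C = jclosure (dominated P) C.

Definition reduction_set (QQ : set (probability Omega R)) (C : set L0c) :=
  [/\ QQ !=set0, QQ `<=` dominated P & C = jclosure QQ C].

Definition aggregator (QQ : set (probability Omega R)) (X : QQ -> L0c)
  (Y : L0c) := forall Q : QQ, prob_eq (val Q) (X Q) Y = 1%E.

Definition coherent (QQ : set (probability Omega R)) (X : QQ -> L0c) :=
  exists Y, aggregator X Y.

Definition stable (QQ : set (probability Omega R)) (C : set L0c) :=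
  forall X : QQ -> L0c, coherent X -> (forall Q : QQ, C (X Q)) ->
  forall Y, aggregator X Y -> C Y.

Lemma repr_qs_eq f : qs_eq P (repr (\pi_L0c f)) f.
Proof.
have /eqmodP /asboolP : repr (\pi_L0c f) = f %[mod L0c] by rewrite reprK.
by [].
Qed.

Lemma jmapE Q f : dominated P Q ->
  jmap Q (\pi_L0c f) = \pi_({mfun_ Q, Omega >-> R}) f.
Proof.
move=> PQ; apply/eqmodP/asboolP; have [N pN sN] := repr_qs_eq f.
exists N; split; [exact: pN.1|exact: PQ|].
move=> w /= nw; apply: contrapT => Nw; apply: nw => _; exact: sN.
Qed.

Lemma prob_eqE Q f g : dominated P Q ->
  prob_eq Q (\pi_L0c f) (\pi_L0c g) = Q [set w | f w = g w].
Proof.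
move=> PQ.
have meas (h k : {mfun Omega >-> R}) : measurable [set w | h w = k w].
  have := @measurable_realfun.measurable_fun_eqr _ _ R setT h k
    (measurable_funPT h) (measurable_funPT k).
  move=> /(_ measurableT [set true] I); rewrite setTI; congr measurable.
  by apply/seteqP; split=> w /= /eqP.
have [N1 p1 s1] := repr_qs_eq f; have [N2 p2 s2] := repr_qs_eq g.
have [mN cN] := polarU P0 p1 p2.
set N := N1 `|` N2 in mN cN.
have QN0 : Q N = 0%E by exact: PQ.
rewrite /prob_eq.
set A := [set w | _ = _]; set B := [set w | _ = _].
have mA : measurable A by exact: meas.
have mB : measurable B by exact: meas.
have QD E : measurable E -> Q E = Q (E `\` N).
  move=> mE; rewrite (@measureDI _ _ _ Q E N)// [X in (_ + X)%E](_ : _ = 0%E) ?adde0//.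
  by apply: (subset_measure0 (B := N)) => //; exact: measurableI.
rewrite (QD _ mA) (QD _ mB); congr (Q _).
apply/seteqP; split=> w [E Nw]; split=> //; move: E; rewrite /A /B /= ;
  have [n1 n2] : ~ N1 w /\ ~ N2 w by split=> ?; apply: Nw; [left|right].
- by rewrite (s1 _ n1) (s2 _ n2).
- by rewrite -(s1 _ n1) -(s2 _ n2).
Qed.

End equivalence.
End quasi_sure.

(* Main.v *)
(* Q[X = Y] = 1 says exactly that j_Q X = j_Q Y.  Hence Y is an aggregator of
   some QQ-coherent family in C if and only if j_Q Y lies in j_Q(C) for every
   Q in QQ (choose a preimage for each Q), i.e. stability means that
   jclosure QQ C is contained in C.  Sensitivity is then automatic, since
   jclosure is antitone in its set of measures. *)

Require Import Defs.
From mathcomp Require Import all_boot all_order all_algebra generic_quotient.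
From mathcomp Require Import all_classical all_reals all_analysis.

Import Order.TTheory.

Local Open Scope classical_set_scope.

(** The set is the preimage of [true] under the measurable boolean map comparing [f w] and [g w]. *)
Lemma measurable_eq_mfun (d : measure_display) (T : measurableType d)
    (R : realType) (f g : {mfun T >-> R}) : measurable [set w | f w = g w].
Proof.
have := @measurable_realfun.measurable_fun_eqr _ _ R setT f g
  (measurable_funPT f) (measurable_funPT g).
move=> /(_ measurableT [set true] I); rewrite setTI; congr measurable.
by apply/seteqP; split=> w /= /eqP.
Qed.

Lemma probability_eq1_ae (d : measure_display) (T : measurableType d)
    (R : realType) (Q : probability T R) (A : set T) :
  measurable A -> Q A = 1%E <-> {ae Q, forall w, A w}.
Proof.
move=> mA; split=> [QA|].
  exists (~` A); split; [exact: measurableC| |by move=> w].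
  by rewrite probability_setC// QA subee.
move=> [N [mN QN sN]]; apply/eqP; rewrite eq_le probability_le1//=.
have <- : Q (~` N) = 1%E by rewrite probability_setC// QN sube0.
apply: le_measure; rewrite ?inE//; first exact: measurableC.
by move=> w Nw; apply: contrapT => /sN.
Qed.

(** Both sides are computed from [repr X] and [repr Y], and both say that these agree [Q]-a.s. *)
Lemma prob_eq1P (d : measure_display) (Omega : measurableType d)
    (R : realType) (P : set (probability Omega R)) (P0 : P !=set0)
    (Q : probability Omega R) (X Y : L0c P0) :
  prob_eq Q X Y = 1%E <-> jmap Q X = jmap Q Y.
Proof.
apply: iff_trans; first exact/probability_eq1_ae/measurable_eq_mfun.
split=> [XY|/eqmodP/asboolP [N [mN QN sN]]].
  (* The quotient relation is a.e. equality on [setT]: the same null set works, up to a trivial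
     premise. *)
  apply/eqmodP/asboolP; case: XY => N [mN QN sN].
  by exists N; split=> // w /= nXY; apply: sN => /= XY; apply: nXY.
by exists N; split=> // w /= nXY; apply: sN => /= XY; apply/nXY/XY.
Qed.

Lemma sub_jclosure (d : measure_display) (Omega : measurableType d)
    (R : realType) (P : set (probability Omega R)) (P0 : P !=set0)
    (QQ : set (probability Omega R)) (C : set (L0c P0)) :
  C `<=` jclosure QQ C.
Proof. by move=> X CX Q _; exists X. Qed.

Lemma stableP (d : measure_display) (Omega : measurableType d)
    (R : realType) (P : set (probability Omega R)) (P0 : P !=set0)
    (QQ : set (probability Omega R)) (C : set (L0c P0)) :
  stable QQ C <-> jclosure QQ C `<=` C.
Proof.
split=> [stC Y clY|clC X _ CX Y aggY].
  have /choice[X XP] (Q : QQ) : exists X, C X /\ jmap (val Q) X = jmap (val Q) Y.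
    by have [X CX XY] := clY _ (set_valP Q); exists X.
  have aggY : aggregator X Y by move=> Q; apply/prob_eq1P; case: (XP Q).
  (* [Y] itself witnesses the coherence of the chosen family. *)
  by apply: (stC X) => // [|Q]; [exists Y|case: (XP Q)].
(* Families are indexed by the subtype of [QQ], so [Q] is packed with its membership proof; [X q] is
   then the preimage in [C]. *)
apply: clC => Q QQQ; pose q : QQ := SigSub (mem_set QQQ).
by exists (X q) => //; apply/prob_eq1P; exact: (aggY q).
Qed.

Theorem proposition5p8 (d : measure_display) (Omega : measurableType d)
    (R : realType) (P : set (probability Omega R)) (P0 : P !=set0)
    (QQ : set (probability Omega R)) (QQ0 : QQ !=set0)
    (QQP : QQ `<=` dominated P) (C : set (L0c P0)) (C0 : C !=set0) :
  sensitive C /\ reduction_set QQ C <-> stable QQ C.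
Proof.
split=> [[_ [_ _ CE]]|/stableP clC]; first by apply/stableP; rewrite -CE.
split; last by split=> //; apply/seteqP; split=> //; exact: sub_jclosure.
apply/seteqP; split; first exact: sub_jclosure.
(* Every [Q] in [QQ] is among the measures over which [clX] ranges. *)
by move=> X clX; apply: clC => Q /QQP; exact: clX.
Qed.
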